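(* Let $S$ be a primitive substitution over a finite alphabet $\mathcal{A}$ with Perron–Frobenius eigenvalue $\theta_S$. There is a constant $C_1=C_1(S)>0$ such that for every initial configuration $\omega_0\in\mathcal{A}^{\mathbb{Z}}$ which is a good approximant, $$d_{\mathcal{H}}\big(\Omega_n(\omega_0),\Omega(S)\big)\le \frac{C_1}{\theta_S^n}\quad\text{for all }n\in\mathbb{N}.$$ If moreover $\Omega(S)$ is aperiodic (infinite) and $\omega_0$ is periodic, then there is a constant $C_2=C_2(\omega_0;S)>0$ such that $$\frac{C_2}{\theta_S^n}\le d_{\mathcal{H}}\big(\Omega_n(\omega_0),\Omega(S)\big)\quad\text{for all }n\in\mathbb{N}.$$
   Context: Configurations are maps $\omega:\mathbb{Z}\to\mathcal{A}$ with shift action $(m\cdot\omega)(n)=\omega(n-m)$ and metric $d(\omega_1,\omega_2)=\inf\{\frac1{r+1}: r\ge0,\ \omega_1|_{(-r,r)}=\omega_2|_{(-r,r)}\}$; a subshift is a nonempty closed shift-invariant set; $d_{\mathcal{H}}$ is the Hausdorff metric on subshifts induced by $d$. A substitution $S:\mathcal{A}\to\mathcal{A}^+$ is extended to words and configurations by concatenation (with $S(\omega(0))$ starting at position $0$); it is primitive if for some $p$, every letter occurs in $S^p(a)$ for all $a$. Its substitution matrix $M(S)$ has $(i,j)$ entry the number of occurrences of $a_i$ in $S(a_j)$; for primitive $S$, $\theta_S$ is its Perron–Frobenius eigenvalue. Legal words $W(S)$ are the subwords of the words $S^n(a)$, $a\in\mathcal{A}$, $n\in\mathbb{N}$; $\Omega(S)$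 is the unique subshift whose set of finite subwords equals $W(S)$. The IHS is $\Omega_n(\omega_0)=\overline{\{m\cdot S^n(\omega_0):m\in\mathbb{Z}\}}$. $G(S)$ is the directed graph on $\mathcal{A}^2$ with an edge $u\to w$ iff $u,w$ are illegal and $w$ is a subword of $S(u)$. $\omega_0$ is a good approximant if every directed path in $G(S)$ starting at a length-$2$ subword of $\omega_0$ contains no closed subpath. $\omega_0$ is periodic if $\omega_0=u^\infty$ for some finite word $u$, i.e. $\omega_0(n)$ depends only on $n$ mod $|u|$. *)

(* Defs.v *)
From HB Require Import structures.
From mathcomp Require Import all_boot all_order all_algebra.
From mathcomp Require Import boolp classical_sets cardinality reals.
From mathcomp Require Import complex.
Set Implicit Arguments.
Unset Strict Implicit.
Unset Printing Implicit Defensive.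
Import Order.TTheory GRing.Theory Num.Theory.
Local Open Scope ring_scope.
Local Open Scope classical_set_scope.

Section Substitutions.
Variable A : finType.

Definition config := int -> A.

Definition shift (m : int) (w : config) : config := fun n => w (n - m).

Definition agree (r : nat) (w1 w2 : config) : Prop :=
  forall n : int, (`|n|%N < r)%N -> w1 n = w2 n.

Definition dist (R : realType) (w1 w2 : config) : R :=
  inf [set (r.+1%:R)^-1 | r in [set r : nat | agree r w1 w2]].

Definition cl (R : realType) (Y : set config) : set config :=
  [set w | forall e : R, 0 < e -> exists2 y, Y y & dist R w y < e].

Definition dH (R : realType) (X Y : set config) : R :=
  Num.max (sup [set inf [set dist R x y | y in Y] | x in X])
          (sup [set inf [set dist R x y | x in X] | y in Y]).

Variable S : A -> seq A.

Definition subst_word (w : seq A) : seq A := flatten (map S w).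

Definition offs (L : nat -> nat) (k : nat) : nat := (\sum_(j < k) L j)%N.
Definition blk (L : nat -> nat) (m : nat) : nat :=
  find (fun k => (m < offs L k.+1)%N) (iota 0 m.+1).

(* extension of S to configurations: S(w(0)) starts at position 0,
   S(w(k+1)) follows S(w(k)), and S(w(-1)) ends at position -1. *)
Definition subst_conf (w : config) : config := fun n =>
  match n with
  | Posz m =>
      let L := fun j : nat => size (S (w (Posz j))) in
      let k := blk L m in
      nth (w (Posz k)) (S (w (Posz k))) (m - offs L k)
  | Negz m => (* position -(m+1); Negz j = -(j+1) *)
      let L := fun j : nat => size (S (w (Negz j))) in
      let k := blk L m in
      nth (w (Negz k)) (S (w (Negz k))) (offs L k.+1 - m.+1)
  end.

Definition primitive : Prop :=
  exists p : nat, forall a b : A, b \in iter p subst_word [:: a].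

Definition subst_matrix (R : pzRingType) : 'M[R]_(#|A|) :=
  \matrix_(i, j) (count_mem (enum_val i) (S (enum_val j)))%:R.

Definition PF_eigenvalue (R : realType) (theta : R) : Prop :=
  let MC := map_mx (fun x : R => (x%:C)%C) (subst_matrix R) in
  eigenvalue MC (theta%:C)%C /\
  forall z : R[i], eigenvalue MC z -> `|z| <= (theta%:C)%C.

Definition legal (w : seq A) : Prop :=
  exists (n : nat) (a : A), infix w (iter n subst_word [:: a]).

Definition subword (w : config) (i : int) (len : nat) : seq A :=
  [seq w (i + j%:Z) | j <- iota 0 len].

Definition Omega : set config :=
  [set w | forall (i : int) (len : nat), legal (subword w i len)].

Definition IHS (R : realType) (w0 : config) (n : nat) : set config :=
  cl R [set shift m (iter n subst_conf w0) | m in [set: int]].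

Definition legalb (w : seq A) : bool := `[< legal w >].
Definition Gedge : rel (A * A) := fun u v =>
  [&& ~~ legalb [:: u.1; u.2], ~~ legalb [:: v.1; v.2]
    & infix [:: v.1; v.2] (S u.1 ++ S u.2)].

(* good approximant: every directed path of G(S) starting at a length-2
   subword of w0 has no closed subpath (i.e. visits no vertex twice) *)
Definition good_approximant (w0 : config) : Prop :=
  forall (i : int) (p : seq (A * A)),
    path Gedge (w0 i, w0 (i + 1)) p -> uniq ((w0 i, w0 (i + 1)) :: p).

Definition periodic (w0 : config) : Prop :=
  exists u : seq A, (0 < size u)%N /\
    forall n : int, w0 n = nth (w0 0) u `|(n %% (size u)%:Z)%Z|%N.

End Substitutions.

(* Main.v *)
(** Upper bound. Two adjacent letters of [S^(n+1)(w0)] either lie in one block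
    [S(a)], hence form a legal word, or straddle the border of two blocks
    [S(a) S(b)]; in the second case illegality of the new pair forces illegality
    of [ab], so that illegal pairs trace a path in [G(S)], which visits no vertex
    twice when [w0] is a good approximant. Thus all pairs of [S^n(w0)] are legal
    as soon as [n >= #|A|^2]. After [m] more steps a window of length at most
    [min_a |S^m(a)|] meets at most two blocks [S^m(x) S^m(y)] with [xy] legal, and
    is legal; conversely every legal word of that length lies in such a pair of
    blocks, and [xy] occurs in [S^q(a)] for all [a] and all large [q].

    Lower bound. [S^n(w0)] is periodic with period [P = |S^n(u)|]. If every element
    of [Omega] agreed with an element of the IHS on [-P, P], then every element of
    [Omega] would be [P]-periodic, by shift invariance, and [Omega] would be finite.

    Both bounds use that [|S^n(a)|] is comparable to [theta^n]. This follows from a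
    positive left eigenvector of the substitution matrix, which is the modulus [f]
    of a complex eigenvector for [theta]: [f M >= theta f], and if the inequality
    were strict somewhere, then [w = f M^p] would satisfy [w M >= (theta + e) w],
    against the bound [O((theta + e/2)^k)] on [w M^k] that Cayley-Hamilton gives. *)

Require Import Defs.
From HB Require Import structures.
From mathcomp Require Import all_boot all_order all_algebra.
From mathcomp Require Import boolp classical_sets cardinality reals.
From mathcomp Require Import complex.
From mathcomp Require Import zify lra.
Import Order.TTheory GRing.Theory Num.Theory.
Local Open Scope ring_scope.
Local Open Scope classical_set_scope.

Set Implicit Arguments.
Unset Strict Implicit.
Unset Printing Implicit Defensive.

(** * Words *)

Section Words.
Variables (A : finType) (S : A -> seq A).

Definition iter_subst (n : nat) (w : seq A) : seq A :=
  iter n (subst_word S) w.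

Lemma iter_substS (n : nat) (w : seq A) :
  iter_subst n.+1 w = subst_word S (iter_subst n w).
Proof. by []. Qed.

Lemma subst_word_cat (u v : seq A) :
  subst_word S (u ++ v) = subst_word S u ++ subst_word S v.
Proof. by rewrite /subst_word map_cat flatten_cat. Qed.

Lemma subst_word_infix (u v : seq A) :
  infix u v -> infix (subst_word S u) (subst_word S v).
Proof.
move=> /infixP[s [t ->]]; apply/infixP; exists (subst_word S s), (subst_word S t).
by rewrite !subst_word_cat.
Qed.

Lemma iter_subst_cat (n : nat) (u v : seq A) :
  iter_subst n (u ++ v) = iter_subst n u ++ iter_subst n v.
Proof. by elim: n => // n IHn; rewrite !iter_substS IHn subst_word_cat. Qed.

Lemma iter_substD (m n : nat) (w : seq A) :
  iter_subst (m + n) w = iter_subst m (iter_subst n w).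
Proof. exact: iterD. Qed.

Lemma iter_subst_nil (n : nat) : iter_subst n [::] = [::].
Proof. by elim: n => // n IHn; rewrite iter_substS IHn. Qed.

Lemma iter_substE (n : nat) (w : seq A) :
  iter_subst n w = flatten [seq iter_subst n [:: a] | a <- w].
Proof.
elim: w => [|a w IHw]; first exact: iter_subst_nil.
by rewrite -cat1s iter_subst_cat IHw.
Qed.

Lemma iter_subst_infix (n : nat) (u v : seq A) :
  infix u v -> infix (iter_subst n u) (iter_subst n v).
Proof.
move=> /infixP[s [t ->]]; apply/infixP; exists (iter_subst n s), (iter_subst n t).
by rewrite !iter_subst_cat.
Qed.

Lemma mem_iter_subst (n : nat) (a : A) (w : seq A) :
  a \in w -> infix (iter_subst n [:: a]) (iter_subst n w).
Proof. by move=> aw; apply: iter_subst_infix; rewrite infix1s. Qed.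

Lemma legal_infix (u v : seq A) : infix u v -> legal S v -> legal S u.
Proof. by move=> uv [n [a va]]; exists n, a; apply: infix_trans va. Qed.

Lemma legal_subst (w : seq A) : legal S w -> legal S (subst_word S w).
Proof. by move=> [n [a wa]]; exists n.+1, a; apply: subst_word_infix. Qed.

Lemma legal_iter_subst (n : nat) (w : seq A) :
  legal S w -> legal S (iter_subst n w).
Proof. by move=> lw; elim: n => //= n IHn; apply: legal_subst. Qed.

Lemma legal_image (a : A) : legal S (S a).
Proof. by exists 1%N, a; rewrite /= /subst_word /= cats0 infix_refl. Qed.

(** Induction on [s]: if [v] starts beyond the first block, that block is dropped; otherwise [v]
    starts inside it and, being no longer than the second block, ends before the third. *)
Lemma infix_flatten_pair (T : A -> seq A) (v s : seq A) :
    (1 < size s)%N -> (forall a, size v <= size (T a))%N ->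
  infix v (flatten (map T s)) ->
  exists x y, infix [:: x; y] s /\ infix v (T x ++ T y).
Proof.
move=> s2 vT; elim: s s2 => // x [|y s] // IHs _.
rewrite -[flatten _]/(T x ++ T y ++ flatten (map T s)).
case: s IHs => [|z s] IHs.
  by rewrite cats0 => vxy; exists x, y; rewrite infix_refl.
move=> vs; have [p [q E]] : exists p q : seq A, _ = p ++ v ++ q := infixP vs.
have [px|px] := leqP (size (T x)) (size p).
  have /IHs : infix v (flatten (map T [:: y, z & s])).
    apply/infixP; exists (drop (size (T x)) p), q.
    rewrite -[flatten _](drop_size_cat _ (erefl (size (T x)))) E drop_cat.
    case: ltnP => [//|px']; have -> : size (T x) = size p.
      by apply/eqP; rewrite eqn_leq px.
    by rewrite subnn drop0 drop_size.
  case=> // a [b [ab vab]]; exists a, b; split=> //.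
  exact: infix_trans ab (infix_cons _ _).
exists x, y; split; first exact: (prefix_infix [:: x; y]).
apply/infixP; exists p, (take (size (T x) + size (T y) - size p - size v) q).
rewrite -[LHS](take_size_cat (flatten (map T (z :: s))) (size_cat _ _)).
rewrite -catA E !take_cat; have := vT y.
case: ltnP => [|_ vy]; first by lia.
by case: ltnP; first lia.
Qed.

(** * Legal words of a primitive substitution *)

Section Primitive.
Hypothesis S_gt0 : forall a, (0 < size (S a))%N.
Variable p : nat.
Hypothesis p_prim : forall a b : A, b \in iter_subst p [:: a].
(** On a one-letter alphabet this excludes the identity substitution, for which no word of two
    letters is legal. *)
Hypothesis p_gt1 : forall a : A, (1 < size (iter_subst p [:: a]))%N.

Lemma size_subst_word (w : seq A) : (size w <= size (subst_word S w))%N.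
Proof.
elim: w => //= a w IHw; rewrite /subst_word /= size_cat.
by have := S_gt0 a; move: IHw; rewrite /subst_word; lia.
Qed.

Lemma size_iter_subst (n : nat) (w : seq A) :
  (size w <= size (iter_subst n w))%N.
Proof. by elim: n => //= n IHn; apply: leq_trans IHn (size_subst_word _). Qed.

Lemma leq_size_iter_subst (m n : nat) (w : seq A) :
  (m <= n)%N -> (size (iter_subst m w) <= size (iter_subst n w))%N.
Proof.
by move=> mn; rewrite -(subnK mn) iter_substD; apply: size_iter_subst.
Qed.

Lemma mem_iter_subst_ge (k : nat) (a b : A) :
  (p <= k)%N -> b \in iter_subst k [:: a].
Proof.
move=> /subnKC <-; rewrite iter_substD.
case E : (iter_subst (k - p) [:: a]) => [|c w].
  by have := size_iter_subst (k - p) [:: a]; rewrite E.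
by rewrite -cat1s iter_subst_cat mem_cat p_prim.
Qed.

(** If [v] lies in [S^n(a)], then [k >= n + p] puts [a] into [S^(k-n)(b)], and applying [S^n] puts
    [v] into [S^k(b)]. *)
Lemma legal_recurrent (v : seq A) : legal S v ->
  exists q, forall k b, (q <= k)%N -> infix v (iter_subst k [:: b]).
Proof.
move=> [n [a va]]; exists (n + p)%N => k b nk.
have -> : (k = n + (k - n))%N by lia.
rewrite iter_substD; apply: infix_trans va _.
by apply: mem_iter_subst; apply: mem_iter_subst_ge; lia.
Qed.

(** By recurrence [v] occurs in [S^m] of the word [S^(q+p)(a)], where it meets at most two blocks;
    the pair below them is legal as a subword of [S^(q+p)(a)]. *)
Lemma legal_desubst (m : nat) (v : seq A) :
    (forall a, size v <= size (iter_subst m [:: a]))%N -> legal S v ->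
  exists x y, legal S [:: x; y] /\ infix v (iter_subst m [:: x; y]).
Proof.
move=> vm lv; have [n [a _]] := lv; have [q qv] := legal_recurrent lv.
have /infix_flatten_pair : infix v
    (flatten [seq iter_subst m [:: b] | b <- iter_subst (q + p) [:: a]]).
  by rewrite -iter_substE -iter_substD; apply: qv; lia.
case=> [|//|x [y [xy vxy]]].
  by apply: leq_trans (p_gt1 a) _; apply: leq_size_iter_subst; lia.
exists x, y; split; first by exists (q + p)%N, a.
by rewrite -cat1s iter_subst_cat.
Qed.

(** The word [v] is found inside the image of the middle letter of a legal word [xyz]; the nonempty
    images of [x] and [z] provide a letter on each side. *)
Lemma legal_extend (v : seq A) : legal S v ->
  exists ab : A * A, legal S (ab.1 :: rcons v ab.2).
Proof.
move=> [k [a /infixP[s [t va]]]].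
have extend u1 u2 : (0 < size u1)%N -> (0 < size u2)%N ->
    legal S (u1 ++ v ++ u2) -> exists ab : A * A, legal S (ab.1 :: rcons v ab.2).
  case/lastP: u1 => // u1 b _; case: u2 => // c u2 _ lv; exists (b, c).
  apply: legal_infix lv; apply/infixP; exists u1, u2.
  by rewrite -cats1 -[in RHS]cat1s /= -!catA -cats1 /= -catA.
have dbl w : (2 * size w <= size (iter_subst p w))%N.
  elim: w => // b w IHw; rewrite -cat1s iter_subst_cat !size_cat /=.
  by have := p_gt1 b; lia.
(* Two applications of [S^p] yield at least four letters, hence a prefix [xyz]. *)
have := dbl (iter_subst p [:: a]); have := p_gt1 a.
case E : (iter_subst p (iter_subst p [:: a])) => [|x [|y [|z w]]] /=;
  do ?by move=> *; lia.
move=> _ _.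
have /(legal_iter_subst k) : legal S (iter_subst p [:: x; y; z]).
  exists (p + (p + p))%N, a; rewrite -!/(iter_subst _ _) !iter_substD E.
  by apply: iter_subst_infix; apply: (prefix_infix [:: x; y; z]).
have nx := size_iter_subst p [:: x]; have nz := size_iter_subst p [:: z].
rewrite -cat1s -(cat1s y) !iter_subst_cat.
(* The letter [a], whose image under [S^k] contains [v], is located in [S^p(y)]. *)
have /path.splitPr[s1 s2] := p_prim y a.
rewrite -(cat1s a) !iter_subst_cat [iter_subst k [:: a]]va => lq.
apply: (extend (iter_subst k (iter_subst p [:: x]) ++ iter_subst k s1 ++ s)
               (t ++ iter_subst k s2 ++ iter_subst k (iter_subst p [:: z]))).
- rewrite size_cat; have := size_iter_subst k (iter_subst p [:: x]).
  by move: nx => /=; lia.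
- rewrite !size_cat; have := size_iter_subst k (iter_subst p [:: z]).
  by move: nz => /=; lia.
by move: lq; rewrite -!catA.
Qed.
End Primitive.
End Words.

(** * Configurations as concatenations *)

Section Subwords.
Variable A : finType.
Implicit Types (x y w : config A) (T S : A -> seq A) (i k : int) (off : int -> int).

Lemma size_subword x i n : size (subword x i n) = n.
Proof. by rewrite size_map size_iota. Qed.

Lemma nth_subword a x i n j : (j < n)%N ->
  nth a (subword x i n) j = x (i + j%:Z).
Proof. by move=> jn; rewrite (nth_map 0%N) ?size_iota // nth_iota. Qed.

Lemma subwordD x i m n :
  subword x i (m + n) = subword x i m ++ subword x (i + m%:Z) n.
Proof.
rewrite /subword iotaD map_cat; congr (_ ++ _).
rewrite add0n -[in iota m n](addn0 m) iotaDl -map_comp; apply: eq_map => j /=.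
by rewrite PoszD addrA.
Qed.

Lemma subword1 x i : subword x i 1 = [:: x i].
Proof. by rewrite /subword /= addr0. Qed.

Lemma subword2 x i : subword x i 2 = [:: x i; x (i + 1)].
Proof. by rewrite /subword /= addr0. Qed.

Lemma subword_infix x i j m n : (j + m <= n)%N ->
  infix (subword x (i + j%:Z) m) (subword x i n).
Proof.
move=> jmn; have -> : n = (j + (m + (n - (j + m))))%N by lia.
by rewrite !subwordD infix_infix.
Qed.

Lemma eq_subword x y i j n :
  (forall t, (t < n)%N -> x (i + t%:Z) = y (j + t%:Z)) ->
  subword x i n = subword y j n.
Proof.
move=> xy; apply: (@eq_from_nth _ (x i)); rewrite ?size_subword // => t tn.
by rewrite !nth_subword // xy.
Qed.

Lemma infix_subword (v : seq A) x i n : infix v (subword x i n) ->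
  exists j, subword x j (size v) = v.
Proof.
move=> vx; have [s [t E]] : exists s t : seq A, _ = s ++ v ++ t := infixP vx.
have en : n = (size s + (size v + size t))%N.
  by rewrite -(size_subword x i n) E !size_cat.
exists (i + (size s)%:Z); move: E; rewrite en !subwordD => /eqP.
rewrite eqseq_cat ?size_subword // => /andP[_].
by rewrite eqseq_cat ?size_subword // => /andP[/eqP].
Qed.

Lemma subword_shift m x i n : subword (shift m x) i n = subword x (i - m) n.
Proof. by apply: eq_subword => t _; rewrite /shift addrAC. Qed.

(* [x] is the bi-infinite concatenation of the words [T (w k)], the [k]-th
   of which starts at position [off k]. *)
Definition tiling T w x (off : int -> int) : Prop := forall k,
  off (k + 1) = off k + (size (T (w k)))%:Z /\
  subword x (off k) (size (T (w k))) = T (w k).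

Lemma tiling_nth T w x off k t a : tiling T w x off ->
  (t < size (T (w k)))%N -> x (off k + t%:Z) = nth a (T (w k)) t.
Proof. by case/(_ k) => _ <-; rewrite size_subword => /nth_subword ->. Qed.

(** Blocks are nonempty, so some block starts at or before [n]; walking right from there, the
    distance to [n] decreases until [n] falls into the current block. *)
Lemma tiling_cover T w x off (n : int) : tiling T w x off ->
    (forall a, 0 < size (T a))%N ->
  exists k t, (t < size (T (w k)))%N /\ n = off k + t%:Z.
Proof.
move=> tl T0.
have below k (d : nat) : n = off k + d%:Z ->
    exists k t, (t < size (T (w k)))%N /\ n = off k + t%:Z.
  elim/ltn_ind: d k => d IHd k nk.
  have [dk|kd] := ltnP d (size (T (w k))); first by exists k, d.
  apply: (IHd (d - size (T (w k)))%N _ (k + 1)); first by have := T0 (w k); lia.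
  by rewrite nk (tl k).1; lia.
have left_off (m : nat) : off (- m%:Z) <= off 0 - m%:Z.
  elim: m => [|m IHm]; first by rewrite oppr0 subr0.
  have := (tl (- m.+1%:Z)).1; have := T0 (w (- m.+1%:Z)).
  by rewrite (_ : - m.+1%:Z + 1 = - m%:Z); lia.
(* This [m] gives [off (-m) <= off 0 - m <= n]. *)
pose m := (absz (off 0%R) + absz n)%N; have := left_off m.
move: (below (- m%:Z)); move: (off (- m%:Z)) => e belowe le_e.
apply: (belowe (absz (n - e)%R)).
by move: le_e; rewrite /m; lia.
Qed.

Lemma tiling_pair T w x off k : tiling T w x off ->
  subword x (off k) (size (T (w k)) + size (T (w (k + 1)))) =
  T (w k) ++ T (w (k + 1)).
Proof. by move=> tl; rewrite subwordD (tl k).2 -(tl k).1 (tl (k + 1)).2. Qed.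

(** The window starts in some block and is no longer than the next one, so it cannot pass the end of
    that next block. *)
Lemma tiling_window T w x off i n : tiling T w x off ->
    (forall a, 0 < size (T a))%N -> (forall a, n <= size (T a))%N ->
  exists k, infix (subword x i n) (T (w k) ++ T (w (k + 1))).
Proof.
move=> tl T0 Tn; have [k [t [tk ->]]] := tiling_cover i tl T0.
by exists k; rewrite -(tiling_pair k tl) subword_infix //; have := Tn (w (k + 1)); lia.
Qed.

Lemma tiling_subst T w x off i n : tiling T w x off ->
  off (i + n%:Z) = off i + (size (subst_word T (subword w i n)))%:Z /\
  subword x (off i) (size (subst_word T (subword w i n)))
    = subst_word T (subword w i n).
Proof.
move=> tl; elim: n => [|n [IHo IHs]]; first by rewrite !addr0.
rewrite -addn1 PoszD addrA subwordD subword1 subst_word_cat size_cat subwordD.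
rewrite PoszD addrA -IHo IHs /subst_word /= cats0.
by have [-> ->] := tl (i + n%:Z).
Qed.

(** [S] turns each tile [T (w k)] into a run of consecutive [S]-tiles, so the boundary maps
    compose. *)
Lemma tiling_comp T S w x y o1 o2 : tiling T w x o1 -> tiling S x y o2 ->
  tiling (fun a => subst_word S (T a)) w y (o2 \o o1).
Proof.
move=> tT tS k /=; rewrite (tT k).1.
by have := tiling_subst (o1 k) (size (T (w k))) tS; rewrite (tT k).2.
Qed.

Lemma tiling_periodic T w x off (q : nat) : tiling T w x off ->
    (forall a, 0 < size (T a))%N -> (forall i, w (i + q%:Z) = w i) ->
  forall i, x (i + (size (subst_word T (subword w 0 q)))%:Z) = x i.
Proof.
move=> tl T0 wq i; set P := size _.
have offP k : off (k + q%:Z) = off k + P%:Z.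
  (* The increments of [off] depend only on the letters of [w], so [off (k + q) - off k] does not
     depend on [k]; at [k = 0] it is [P]. *)
  have step (j : int) : off (j + 1 + q%:Z) - off (j + 1) = off (j + q%:Z) - off j.
    by rewrite (addrAC j) !(tl _).1 wq opprD addrACA subrr addr0.
  suff : off (k + q%:Z) - off k = off (0 + q%:Z) - off 0.
    by rewrite (tiling_subst 0 q tl).1 -/P; lia.
  elim/int_rect: k => // k IHk.
  - by rewrite -addn1 PoszD step.
  - by rewrite -step -addn1 PoszD opprD addrNK.
have [k [t [tk ->]]] := tiling_cover i tl T0.
rewrite addrAC -offP (tiling_nth (x 0) tl tk).
by rewrite (tiling_nth (x 0) tl) wq.
Qed.

(** Positive lengths make [offs L] strictly increasing. Hence [k <= offs L k], so [k] is within the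
    range searched by [blk], and no smaller index passes the test. *)
Lemma blk_eq (L : nat -> nat) (k t : nat) : (forall j, 0 < L j)%N ->
  (t < L k)%N -> blk L (offs L k + t) = k.
Proof.
move=> L0 tk; rewrite /blk; set m := (offs L k + t)%N.
have offsS j : offs L j.+1 = (offs L j + L j)%N by rewrite /offs big_ord_recr.
have mono (i d : nat) : (offs L i + d <= offs L (i + d))%N.
  elim: d => [|d IHd]; first by rewrite !addn0.
  by rewrite !addnS offsS; have := L0 (i + d)%N; lia.
have km : (k <= m)%N by have := mono 0%N k; rewrite add0n /m; lia.
have -> : iota 0 m.+1 = iota 0 k ++ iota k (m - k).+1.
  by rewrite -[in RHS](add0n k) -iotaD; congr iota; lia.
rewrite find_cat ifN; last first.
  apply/hasPn => j; rewrite mem_iota => /andP[_ jk].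
  by have := mono j.+1 (k - j.+1)%N; rewrite subnKC // /m; lia.
by rewrite size_iota /= offsS /m ltn_add2l tk addn0.
Qed.

Lemma subst_conf_tiling S w : (forall a, 0 < size (S a))%N ->
  exists off, tiling S w (subst_conf S w) off.
Proof.
move=> S0.
pose Lp j := size (S (w (Posz j))); pose Ln j := size (S (w (Negz j))).
exists (fun k => match k with Posz k => (offs Lp k)%:Z
                            | Negz j => - (offs Ln j.+1)%:Z end).
have offsS L j : offs L j.+1 = (offs L j + L j)%N by rewrite /offs big_ord_recr.
case=> [k|j]; split.
- have -> : Posz k + 1 = Posz k.+1 by lia.
  by rewrite offsS PoszD.
- apply: (@eq_from_nth _ (w k)); rewrite size_subword // => t tk.
  rewrite nth_subword // -PoszD /= (@blk_eq Lp k t) // ?addKn // => j.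
  exact: S0.
- case: j => [|j]; first by rewrite /offs big_ord1 /= big_ord0 addNr.
  have -> : Negz j.+1 + 1 = Negz j by lia.
  by rewrite (offsS _ j.+1) /Ln; lia.
- apply: (@eq_from_nth _ (w (Negz j))); rewrite size_subword // => t tj.
  have tj' : (t < Ln j)%N by [].
  (* Left of the origin [subst_conf] counts blocks and letters leftwards: letter [t] of the block is
     the [(Ln j - t.+1)]-th from its right end, counting from zero. *)
  rewrite nth_subword // (_ : _ + _ = Negz (offs Ln j + (Ln j - t.+1))); last first.
    by rewrite offsS; lia.
  have blkE : blk Ln (offs Ln j + (Ln j - t.+1)) = j.
    by apply: blk_eq => [i|]; [exact: S0 | lia].
  rewrite /= -/Ln blkE; congr nth; rewrite -/(offs Ln j.+1) offsS; lia.
Qed.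

Lemma iter_subst_conf_tiling S w n : (forall a, 0 < size (S a))%N ->
  exists off, tiling (fun a => iter_subst S n [:: a]) w
                     (iter n (subst_conf S) w) off.
Proof.
move=> S0; elim: n => [|n [o1 t1]].
  by exists id => k; rewrite /iter_subst /= subword1.
have [o2 t2] := subst_conf_tiling (iter n (subst_conf S) w) S0.
by exists (o2 \o o1); apply: tiling_comp t2.
Qed.

End Subwords.

(** * Good approximants and the subshift *)

Section Approximants.
Variables (A : finType) (S : A -> seq A).
Hypothesis S_gt0 : forall a, (0 < size (S a))%N.

(** The only adjacent pair of [S a ++ S b] that lies in neither factor, hence the only one that can
    be illegal. *)
Definition boundary (u : A * A) : A * A :=
  (last u.1 (S u.1), head u.2 (S u.2)).

Lemma boundary_infix (u : A * A) :
  infix [:: (boundary u).1; (boundary u).2] (S u.1 ++ S u.2).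
Proof.
case: u => a b; have := S_gt0 a; have := S_gt0 b; rewrite /boundary.
case/lastP: (S a) => // s c; case: (S b) => // d t _ _.
rewrite /fst /snd last_rcons -cats1 -catA.
exact: (infix_infix s [:: c; d] t).
Qed.

Lemma legal_boundary (u : A * A) : legal S [:: u.1; u.2] ->
  legal S [:: (boundary u).1; (boundary u).2].
Proof.
move=> /legal_subst; rewrite /subst_word /= cats0.
exact/legal_infix/boundary_infix.
Qed.

Lemma tiling_two (w x : config A) off i : tiling S w x off ->
  exists k, infix [:: x i; x (i + 1)] (S (w k)) \/
            (x i, x (i + 1)) = boundary (w k, w (k + 1)).
Proof.
move=> tl; have [k [t [tk ->]]] := tiling_cover i tl S_gt0; exists k.
have [t1k|kt] := ltnP t.+1 (size (S (w k))); [left|right].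
  by rewrite -subword2 -[X in infix _ X](tl k).2 subword_infix // addn2.
have tE : t.+1 = size (S (w k)) by apply/eqP; rewrite eqn_leq tk.
congr (_, _); first by rewrite (tiling_nth (w k) tl tk) -nth_last -tE.
rewrite -addrA -PoszD addn1 tE -(tl k).1 -[off _]addr0.
by rewrite (tiling_nth (w (k + 1)) tl) ?nth0.
Qed.

(** A pair of [S^n(w0)] is legal or is the [n]-th iterate of [boundary] at a pair of [w0]. Since
    [boundary] preserves legality, an illegal iterate has only illegal predecessors, and these form
    a path in [G(S)]. *)
Lemma good_approximant_legal (w0 : config A) n i :
    good_approximant S w0 -> (#|{: A * A}| <= n)%N ->
  legal S (subword (iter n (subst_conf S) w0) i 2).
Proof.
move=> good An; rewrite subword2.
have [k] : exists k, legal S (subword (iter n (subst_conf S) w0) i 2) \/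
    (iter n (subst_conf S) w0 i, iter n (subst_conf S) w0 (i + 1))
      = iter n boundary (w0 k, w0 (k + 1)).
  elim: n i {An} => [|n IHn] i; first by exists i; right.
  have [off tl] := subst_conf_tiling (iter n (subst_conf S) w0) S_gt0.
  have [j] := tiling_two i tl; rewrite -/(iter n.+1 (subst_conf S) w0) => -[xS|xb].
    by exists j; left; rewrite subword2; apply: legal_infix xS (legal_image _ _).
  have [k [lw|wk]] := IHn j; exists k.
    left; rewrite subword2 in lw; rewrite subword2.
    by have := legal_boundary (u := (_, _)) lw; rewrite -xb.
  by right; rewrite xb wk.
rewrite subword2 => -[//|xE]; apply: contrapT => illegal.
have illegal_iter m : (m <= n)%N -> ~~ legalb S
    [:: (iter m boundary (w0 k, w0 (k + 1))).1; (iter m boundary (w0 k, w0 (k + 1))).2].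
  move=> mn; apply/asboolPn => lm; apply: illegal.
  have : legal S [:: (iter n boundary (w0 k, w0 (k + 1))).1;
                     (iter n boundary (w0 k, w0 (k + 1))).2].
    rewrite -(subnK mn) iterD; move: lm; move: (iter m _ _) => u lu.
    by elim: (n - m)%N => //= d IHd; apply: legal_boundary.
  by rewrite -xE.
set u0 := (w0 k, w0 (k + 1)) in illegal_iter *.
have path_u m : (m <= n)%N ->
    path (Gedge S) u0 (traject boundary (boundary u0) m).
  elim: m => // m IHm mn; rewrite trajectSr rcons_path IHm; last exact: ltnW.
  have -> : last u0 (traject boundary (boundary u0) m) = iter m boundary u0.
    by case: m {IHm mn} => // m; rewrite last_traject iterSr.
  rewrite -iterSr /Gedge illegal_iter ?illegal_iter //; last exact: ltnW.
  exact: boundary_infix.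
have us := good k _ (path_u n (leqnn n)).
(* The path has [n + 1] distinct vertices, more than there are pairs. *)
have := max_card (mem (u0 :: traject boundary (boundary u0) n)).
by rewrite (card_uniqP us) /= size_traject ltnNge An.
Qed.

End Approximants.

(** * Extending legal words to elements of the subshift *)

Section Extension.
Variables (A : finType) (S : A -> seq A).

Lemma agree_subword r (x y : config A) :
  agree r.+1 x y <-> subword x (- r%:Z) (2 * r).+1 = subword y (- r%:Z) (2 * r).+1.
Proof.
split=> [xy|xy j jr].
  by apply: eq_subword => t tr; apply: xy; lia.
have := congr1 (fun v => nth (x 0) v (absz (j + r%:Z))) xy.
by rewrite !nth_subword; do ?lia; rewrite (_ : - _ + _ = j) //; lia.
Qed.

Lemma agree_le r s (x y : config A) : (r <= s)%N -> agree s x y -> agree r x y.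
Proof. by move=> rs xy j jr; apply: xy; apply: leq_trans rs. Qed.

Lemma agree_trans r (x y z : config A) : agree r x y -> agree r y z -> agree r x z.
Proof. by move=> xy yz j jr; rewrite xy // yz. Qed.

(** The legal central window is enlarged by one letter on each side again and again, and the
    resulting configurations converge. *)
Lemma Omega_extension (r : nat) (x : config A) :
    (forall v, legal S v -> exists ab : A * A, legal S (ab.1 :: rcons v ab.2)) ->
  legal S (subword x (- r%:Z) (2 * r).+1) ->
  exists2 y, Omega S y & agree r.+1 x y.
Proof.
move=> ext lx.
(* Legality is a premise under the existential, so that choice gives a map [next] defined for all
   [k] and [z]. *)
have step (k : nat) (z : config A) : exists z', legal S (subword z (- k%:Z) (2 * k).+1) ->
    agree k.+1 z z' /\ legal S (subword z' (- k.+1%:Z) (2 * k.+1).+1).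
  have [/ext[[a b] lab]|nz] := pselect (legal S (subword z (- k%:Z) (2 * k).+1));
    last by exists z.
  pose z' := fun j : int => if (absz j < k.+1)%N then z j else if j < 0 then a else b.
  exists z' => _; have zz' : agree k.+1 z z' by move=> j jk; rewrite /z' jk.
  split=> //; rewrite (_ : (2 * k.+1).+1 = (1 + ((2 * k).+1 + 1)))%N; last by lia.
  rewrite 2!subwordD !subword1 cats1 (_ : - k.+1%:Z + 1%:Z = - k%:Z); last by lia.
  move/agree_subword: (zz') => <-; rewrite /z'.
  do 3![rewrite ifF; last by lia].
  exact: lab.
pose next k z := projT1 (cid (step k z)).
pose X := fix X n := if n is m.+1 then next (r + m)%N (X m) else x.
have lX n : legal S (subword (X n) (- (r + n)%:Z) (2 * (r + n)).+1).
  elim: n => [|n IHn]; first by rewrite addn0.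
  by rewrite addnS /=; apply: (projT2 (cid (step (r + n)%N (X n))) IHn).2.
have aX n d : agree (r + n).+1 (X n) (X (n + d)%N).
  elim: d => [|d IHd]; first by rewrite addn0.
  apply: agree_trans IHd _; rewrite addnS.
  have [aS _] := projT2 (cid (step (r + (n + d))%N (X (n + d)%N))) (lX _).
  by apply: agree_le aS; lia.
(* Diagonal limit: from stage [|j|] on, the letter at [j] no longer changes. *)
pose y : config A := fun j => X (absz j) j.
have aXy n : agree (r + n).+1 (X n) y.
  move=> j jn; rewrite /y; have [nj|jn'] := leqP n (absz j).
    by rewrite -(subnKC nj); apply: aX.
  by rewrite -(subnKC (ltnW jn')) -aX //; lia.
exists y; last by have := aXy 0%N; rewrite addn0.
move=> i len; pose n := (absz i + len)%N.
apply: legal_infix (lX n); have /agree_subword -> := aXy n.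
rewrite (_ : i = - (r + n)%:Z + (absz (i + (r + n)%:Z))%:Z) ?subword_infix //.
all: by rewrite /n; lia.
Qed.

Lemma Omega_shift m (x : config A) : Omega S x -> Omega S (shift m x).
Proof. by move=> xO i n; rewrite subword_shift. Qed.

End Extension.

(** * Perron-Frobenius *)

Section SpectralBound.

(** Induction on the factors. With [y = x (M - z)], killed by the remaining factors,
    [x M^(k+1) = y M^k + z (x M^k)] is a recursion with [|z| <= t < t']. *)
Lemma prodXsub_orbit_bound (C : numFieldType) n (M : 'M[C]_n) (rs : seq C)
    (t t' : C) (x : 'rV[C]_n) : 0 <= t -> t < t' ->
    (forall z, z \in rs -> `|z| <= t) ->
    foldl (fun y z => y *m (M - z%:M)) x rs = 0 ->
  exists D : C, 0 <= D /\
    forall k j, `|iter k (mulmxr M) x 0 j| <= D * t' ^+ k.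
Proof.
move=> t0 tt'; elim: rs x => [|z rs IHrs] x /= rst x0.
  exists 0; split=> // k j; have -> : iter k (mulmxr M) x = 0.
    by elim: k => [|k IHk] //=; rewrite IHk mul0mx.
  by rewrite mxE normr0 mul0r.
have [|D' [D'0 yD']] := IHrs _ _ x0; first by move=> y yrs; apply: rst; rewrite inE yrs orbT.
have tt0 : 0 < t' - t by rewrite subr_gt0.
(* The sum covers [k = 0]; the quotient ensures [D' + t D <= t' D], which closes the induction on
   [k]. *)
exists (\sum_j `|x 0 j| + D' / (t' - t)).
have D0 : 0 <= \sum_j `|x 0 j| + D' / (t' - t).
  by rewrite addr_ge0 ?sumr_ge0 // divr_ge0 // ltW.
split=> // k j; elim: k j => [|k IHk] j.
  rewrite expr0 mulr1 (bigD1 j) //= -addrA lerDl addr_ge0 ?sumr_ge0 //.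
  by rewrite divr_ge0 // ltW.
have -> : iter k.+1 (mulmxr M) x 0 j
    = iter k (mulmxr M) (x *m (M - z%:M)) 0 j + z * iter k (mulmxr M) x 0 j.
  have -> : iter k (mulmxr M) (x *m (M - z%:M))
      = iter k.+1 (mulmxr M) x - z *: iter k (mulmxr M) x.
    elim: k {IHk} => [|k IHk] /=; first by rewrite mulmxBr mul_mx_scalar.
    by rewrite IHk /= mulmxBl -scalemxAl.
  by rewrite !mxE subrK.
apply: le_trans (ler_normD _ _) _; rewrite normrM.
apply: le_trans (lerD (yD' k j) (ler_pM _ _ (rst z (mem_head _ _)) (IHk j))) _ => //.
rewrite exprS !mulrA -mulrDl; apply: ler_wpM2r.
  by rewrite exprn_ge0 // (le_trans t0) // ltW.
rewrite -lerBrDr [t * _]mulrC -mulrBr mulrDl divfK ?gt_eqF // lerDr.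
by rewrite mulr_ge0 ?sumr_ge0 // ltW.
Qed.

Lemma spectral_radius_bound (C : numClosedFieldType) n (M : 'M[C]_n)
    (t t' : C) (x : 'rV[C]_n) : 0 <= t -> t < t' ->
    (forall z, eigenvalue M z -> `|z| <= t) ->
  exists D : C, 0 <= D /\
    forall k j, `|iter k (mulmxr M) x 0 j| <= D * t' ^+ k.
Proof.
case: n M x => [|n] M x t0 tt' Mt; first by exists 0; split=> // k [].
have [rs rsE] := closed_field_poly_normal (char_poly M).
have {}rsE : char_poly M = \prod_(z <- rs) ('X - z%:P).
  by rewrite rsE (monicP (char_poly_monic M)) scale1r.
apply: (@prodXsub_orbit_bound _ _ M rs t) => // [z zrs|].
  by apply: Mt; rewrite eigenvalue_root_char rsE root_prod_XsubC.
have foldlE y : foldl (fun y z => y *m (M - z%:M)) y rs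
    = y *m horner_mx M (\prod_(z <- rs) ('X - z%:P)).
  elim: rs y {rsE} => [|z rs IHrs] y; first by rewrite big_nil rmorph1 mulmx1.
  rewrite /= big_cons rmorphM /= IHrs -mulmxA -mulmxE.
  by rewrite rmorphB /= horner_mx_X horner_mx_C.
by rewrite foldlE -rsE Cayley_Hamilton mulmx0.
Qed.

(** Bernoulli's inequality for [s / t = 1 + h], then the Archimedean property. *)
Lemma geometric_overtake (R : archiRealFieldType) (s t c D : R) :
  0 < t -> t < s -> 0 < c -> exists k : nat, D * t ^+ k < c * s ^+ k.
Proof.
move=> t0 ts c0; pose h := s / t - 1.
have h0 : 0 < h by rewrite subr_gt0 ltr_pdivlMr // mul1r.
have bernoulli k : 1 + k%:R * h <= (1 + h) ^+ k.
  elim: k => [|k IHk]; first by rewrite mul0r addr0.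
  rewrite exprS; apply: le_trans (ler_wpM2l _ IHk); last by rewrite addr_ge0 // ltW.
  have : 0 <= h * (k%:R * h) by rewrite !mulr_ge0 // ltW.
  by rewrite -natr1; lra.
have := archi_boundP (normr_ge0 (D / c / h)); set k := Num.Def.archi_bound _ => kD.
exists k; have sE : s = (1 + h) * t by rewrite /h subrKC divfK ?gt_eqF.
rewrite sE exprMn mulrA ltr_pM2r ?exprn_gt0 // mulrC -ltr_pdivrMr //.
apply: lt_le_trans (bernoulli k).
have := le_lt_trans (ler_norm _) kD; rewrite ltr_pdivrMr //; lra.
Qed.

(** The reciprocal of [1 + sum 1/f] replaces a minimum; the summand [1] keeps it meaningful for an
    empty [A]. *)
Lemma finite_lower_bound (R : realFieldType) (A : finType) (f : A -> R) :
  (forall a, 0 < f a) -> exists2 m, 0 < m & forall a, m <= f a.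
Proof.
move=> f0; have s0 : 0 < 1 + \sum_a (f a)^-1.
  by rewrite ltr_wpDr // sumr_ge0 // => a _; rewrite invr_ge0 ltW.
exists (1 + \sum_a (f a)^-1)^-1; first by rewrite invr_gt0.
move=> a; rewrite -[leRHS]invrK lef_pV2 ?posrE ?invr_gt0 //.
rewrite (bigD1 a) //= addrCA lerDl addr_ge0 // sumr_ge0 // => b _.
by rewrite invr_ge0 ltW.
Qed.

End SpectralBound.

(** * Positive left eigenvector and growth of word lengths *)

Section PerronFrobenius.
Variables (A : finType) (S : A -> seq A).

(** The action [f M] of the substitution matrix on row vectors, indexed by letters; the general
    codomain serves real and complex vectors alike. *)
Definition sum_image (V : nmodType) (f : A -> V) : A -> V :=
  fun a => \sum_(b <- S a) f b.

Lemma iter_sum_imageS (V : nmodType) (f : A -> V) n a :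
  iter n.+1 (@sum_image V) f a = \sum_(b <- S a) iter n (@sum_image V) f b.
Proof. by []. Qed.

Lemma iter_sum_image (V : nmodType) (f : A -> V) n a :
  iter n (@sum_image V) f a = \sum_(b <- iter_subst S n [:: a]) f b.
Proof.
elim: n a => [|n IHn] a; first by rewrite big_seq1.
have -> : iter_subst S n.+1 [:: a] = iter_subst S n (S a).
  by rewrite /iter_subst iterSr /subst_word /= cats0.
rewrite iter_substE big_flatten big_map iter_sum_imageS.
by apply: eq_bigr => b _; rewrite IHn.
Qed.

Lemma sum_count (R : pzSemiRingType) (f : A -> R) (s : seq A) :
  \sum_(b <- s) f b = \sum_a f a * (count_mem a s)%:R.
Proof.
elim: s => [|b s IHs]; first by rewrite big_nil big1 // => a _; rewrite mulr0.
rewrite big_cons IHs /= [in RHS](eq_bigr (fun a =>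
  f a * (b == a)%:R + f a * (count_mem a s)%:R)); last first.
  by move=> a _; rewrite natrD mulrDr.
rewrite big_split /=; congr (_ + _).
rewrite (bigD1 b) //= eqxx mulr1 big1 ?addr0 // => a /negbTE ab.
by rewrite eq_sym ab mulr0.
Qed.

Lemma row_sum_image (R : comPzRingType) (f : A -> R) :
  \row_j f (enum_val j) *m subst_matrix S R = \row_j sum_image f (enum_val j).
Proof.
apply/rowP => j; rewrite !mxE /sum_image sum_count.
rewrite [RHS](reindex (fun i : 'I_#|A| => enum_val i)) /=; last first.
  exact/onW_bij/enum_val_bij.
by apply: eq_bigr => i _; rewrite !mxE.
Qed.

Variables (R : realType) (theta : R).
Hypothesis Htheta : PF_eigenvalue S theta.
Variable p : nat.
Hypothesis p_prim : forall a b : A, b \in iter_subst S p [:: a].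

Let MC := map_mx (fun x : R => (x%:C)%C) (subst_matrix S R).

Let MCE : MC = subst_matrix S R[i].
Proof. by apply/matrixP => i j; rewrite !mxE rmorph_nat. Qed.

(** The bound on moduli, applied to the eigenvalue [theta] itself, reads [|theta| <= theta]. *)
Let theta_ge0 : 0 <= theta.
Proof.
have [e /(_ _ e) /(le_trans (normr_ge0 _))] := Htheta.
by rewrite lecR.
Qed.

Let sum_image_gt0 (f : A -> R) a0 a : (forall b, 0 <= f b) -> 0 < f a0 ->
  0 < iter p (@sum_image R) f a.
Proof.
move=> f0 fa0; rewrite iter_sum_image (big_rem a0) //= ltr_pwDl // sumr_ge0 //.
Qed.

(* An everywhere positive [w] that grows faster than [theta] would contradict
   the bound on the moduli of the complex eigenvalues. *)
Let no_superharmonic (w : A -> R) (e : R) (a : A) : 0 < e -> (forall b, 0 < w b) ->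
  ~ forall b, (theta + e) * w b <= sum_image w b.
Proof.
move=> e0 w0 wge.
(* The rate [theta + e / 2] exceeds all eigenvalue moduli and is less than the growth rate
   [theta + e] of [w]. *)
have te : 0 < theta + e / 2 by rewrite ltr_wpDl // divr_gt0.
have [|||D [D0 wD]] := @spectral_radius_bound R[i] _ MC (theta%:C)%C
    ((theta + e / 2)%:C)%C (\row_j ((w (enum_val j))%:C)%C).
- by rewrite lecR.
- by rewrite ltcR ltrDl divr_gt0.
- exact: Htheta.2.
have wC k : iter k (mulmxr MC) (\row_j ((w (enum_val j))%:C)%C)
    = \row_j ((iter k (@sum_image R) w (enum_val j))%:C)%C.
  elim: k => // k IHk; rewrite iterS IHk /= MCE.
  rewrite (row_sum_image (fun a => ((iter k (@sum_image R) w a)%:C)%C)).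
  by apply/rowP => j; rewrite !mxE /sum_image rmorph_sum.
have {wC}wD k : iter k (@sum_image R) w a <= complex.Re D * (theta + e / 2) ^+ k.
  have := wD k (enum_rank a); rewrite wC mxE enum_rankK.
  have -> : D = ((complex.Re D)%:C)%C by rewrite (RRe_real (ger0_real D0)).
  rewrite -rmorphXn -rmorphM /= => /(le_trans _); rewrite -lecR; apply.
  by apply: real_ler_norm; rewrite complex_real.
have wge_iter k b : (theta + e) ^+ k * w b <= iter k (@sum_image R) w b.
  elim: k b => [|k IHk] b; first by rewrite mul1r.
  rewrite iter_sum_imageS exprSr -mulrA.
  apply: (@le_trans _ _ ((theta + e) ^+ k * sum_image w b)).
    by rewrite ler_wpM2l // exprn_ge0 // addr_ge0 // ltW.
  by rewrite mulr_sumr; apply: ler_sum => c _; apply: IHk.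
have [|k] := @geometric_overtake R (theta + e) _ (w a) (complex.Re D) te _ (w0 a).
  by rewrite ltrD2l ltr_pdivrMr // ltr_pMr // ltr1n.
rewrite ltNge => /negP; apply; apply: le_trans (wD k).
by rewrite mulrC.
Qed.

Lemma perron_eigenvector : exists l : A -> R,
  (forall a, 0 < l a) /\ forall a, \sum_(b <- S a) l b = theta * l a.
Proof.
have [/eigenvalueP[v vM v0] _] := Htheta; rewrite -/MC MCE in vM.
pose g a := v 0 (enum_rank a); pose f a := complex.Re `|g a|.
have fE a : `|g a| = ((f a)%:C)%C by rewrite /f normc_def.
have gE a : sum_image g a = (theta%:C)%C * g a.
  have : v = \row_j g (enum_val j) by apply/rowP => j; rewrite mxE /g enum_valK.
  move=> vE; rewrite vE row_sum_image in vM.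
  by have /rowP/(_ (enum_rank a)) := vM; rewrite !mxE enum_rankK.
have f0 a : 0 <= f a by rewrite -lecR -fE; apply: normr_ge0.
have [a0 fa0] : exists a0, 0 < f a0.
  have /matrix0Pn[i [j vij]] := v0; exists (enum_val j).
  rewrite -ltcR -fE normr_gt0 /g enum_valK.
  by rewrite (ord1 i) in vij.
(* Triangle inequality applied to the eigenvector equation. *)
have f_super a : theta * f a <= sum_image f a.
  rewrite -lecR rmorphM rmorph_sum /= -fE.
  have -> : (theta%:C)%C * `|g a| = `|sum_image g a|.
    by rewrite gE normrM ger0_norm // lecR.
  by apply: le_trans (ler_norm_sum _ _ _) _; apply: ler_sum => b _; rewrite fE.
(* In case of equality [theta^p f = f M^p] is positive everywhere by primitivity, so [f] has no
   zero. *)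
have [fE'|] := pselect (forall a, sum_image f a = theta * f a).
  exists f; split=> // a; rewrite lt_neqAle f0 andbT eq_sym.
  have := sum_image_gt0 a f0 fa0.
  have -> : iter p (@sum_image R) f a = theta ^+ p * f a.
    elim: p a => [|k IHk] a; first by rewrite mul1r.
    rewrite iter_sum_imageS exprSr -mulrA -fE' mulr_sumr.
    by apply: eq_bigr => b _; rewrite IHk.
  by apply: contraTneq => ->; rewrite mulr0 ltxx.
move=> /existsNP[a1 /eqP fa1].
(* The defect [h] is nonnegative and not zero, so [w M - theta w = h M^p] is positive everywhere;
   finiteness of [A] then yields a uniform relative excess [e]. *)
pose h a := sum_image f a - theta * f a.
have h0 a : 0 <= h a by rewrite subr_ge0.
have ha1 : 0 < h a1 by rewrite lt_neqAle h0 andbT eq_sym subr_eq0.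
pose w := iter p (@sum_image R) f.
have w0 a : 0 < w a by apply: sum_image_gt0 fa0.
have wh a : sum_image w a - theta * w a = iter p (@sum_image R) h a.
  rewrite !iter_sum_image -iterS iterSr /w !iter_sum_image.
  by rewrite mulr_sumr -sumrB.
have [|e e0 we] := @finite_lower_bound R A (fun a => (sum_image w a - theta * w a) / w a).
  by move=> a; rewrite divr_gt0 // wh; apply: sum_image_gt0 ha1.
have [] := @no_superharmonic w e a0 e0 w0.
by move=> b; have := we b; rewrite ler_pdivlMr // mulrDl; lra.
Qed.

(** With letters weighted by the eigenvector [l], the word [S^n(a)] has weight exactly
    [theta^n l(a)]; the bounds [m <= l <= M] convert weights into lengths. *)
Lemma size_iter_subst_growth : exists c C : R, 0 < c /\ 0 < C /\ forall n a,
  c * theta ^+ n <= (size (iter_subst S n [:: a]))%:R <= C * theta ^+ n.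
Proof.
have [l [l0 lE]] := perron_eigenvector.
have [m m0 ml] := finite_lower_bound l0.
pose M := 1 + \sum_a l a.
have M0 : 0 < M by rewrite ltr_wpDr // sumr_ge0 // => a _; rewrite ltW.
have lM a : l a <= M.
  by rewrite /M (bigD1 a) //= addrCA lerDl addr_ge0 // sumr_ge0 // => b _; rewrite ltW.
have lEn n a : \sum_(b <- iter_subst S n [:: a]) l b = theta ^+ n * l a.
  rewrite -iter_sum_image; elim: n a => [|n IHn] a; first by rewrite mul1r.
  rewrite iter_sum_imageS exprSr -mulrA -lE mulr_sumr.
  by apply: eq_bigr => b _; rewrite IHn.
have sumc (s : seq A) (c : R) : \sum_(b <- s) c = c * (size s)%:R.
  by rewrite big_const_seq count_predT iter_addr_0 mulr_natr.
exists (m / M), (M / m); rewrite !divr_gt0 //; do 2!split=> //; move=> n a.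
have tn : 0 <= theta ^+ n by rewrite exprn_ge0.
apply/andP; split.
  rewrite mulrAC ler_pdivrMr // -[leRHS]mulrC -sumc.
  apply: (@le_trans _ _ (theta ^+ n * l a)); first by rewrite mulrC ler_wpM2l.
  by rewrite -lEn; apply: ler_sum => b _.
rewrite mulrAC ler_pdivlMr // mulrC -sumc.
apply: (@le_trans _ _ (theta ^+ n * l a)); last by rewrite mulrC ler_wpM2r.
by rewrite -lEn; apply: ler_sum => b _.
Qed.

End PerronFrobenius.

(** * Hausdorff distance *)

Section Distances.
Variables (A : finType) (R : realType).
Implicit Types (x y : config A) (X Y : set (config A)).

Let dist_set_lb x y :
  has_lbound ([set (r.+1%:R)^-1 | r in [set r : nat | agree r x y]] : set R).
Proof. by exists 0 => _ [r _ <-]; rewrite invr_ge0. Qed.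

Let dist_set_n0 x y :
  ([set (r.+1%:R)^-1 | r in [set r : nat | agree r x y]] : set R) !=set0.
Proof. by exists (1%:R)^-1, 0%N. Qed.

Lemma dist_le r x y : agree r x y -> dist R x y <= (r.+1%:R)^-1.
Proof. by move=> xy; apply: (ge_inf (dist_set_lb x y)); exists r. Qed.

Lemma dist_le1 x y : dist R x y <= 1.
Proof. by have := @dist_le 0%N x y; rewrite invr1; apply. Qed.

Lemma dist_ge0 x y : 0 <= dist R x y.
Proof. by apply: (lb_le_inf (dist_set_n0 x y)) => _ [r _ <-]; rewrite invr_ge0. Qed.

(** The infimum runs over reciprocals of positive integers, so a strict inequality gains one unit of
    radius. *)
Lemma dist_lt_agree r x y : dist R x y < (r.+1%:R)^-1 -> agree r.+1 x y.
Proof.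
move=> /(inf_lt (dist_set_n0 x y))[_ [s xy <-]].
rewrite ltf_pV2 ?posrE ?ltr0n // ltr_nat ltnS => rs.
exact: agree_le rs xy.
Qed.

Lemma cl_incl Y y : Y y -> cl R Y y.
Proof.
move=> Yy e e0; exists y => //; pose k := Num.Def.archi_bound e^-1.
apply: (@le_lt_trans _ _ (k.+1%:R)^-1); first exact: dist_le.
rewrite -[ltRHS]invrK ltf_pV2 ?posrE ?invr_gt0 ?ltr0n //.
apply: lt_trans (archi_boundP _) _; first by rewrite invr_ge0 ltW.
by rewrite ltr_nat.
Qed.

Lemma cl_agree Y x r : cl R Y x -> exists2 y, Y y & agree r x y.
Proof.
have e0 : 0 < (r.+1%:R)^-1 :> R by rewrite invr_gt0 ltr0n.
move=> /(_ _ e0)[y Yy /dist_lt_agree xy]; exists y => //.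
by apply: agree_le xy.
Qed.

Lemma dH_le X Y b : X !=set0 ->
    (forall x, X x -> exists2 y, Y y & dist R x y <= b) ->
    (forall y, Y y -> exists2 x, X x & dist R x y <= b) ->
  dH R X Y <= b.
Proof.
(* A point of [Y] is extracted too: both suprema must range over nonempty sets. *)
move=> [x0 Xx0] XY YX; have [y0 Yy0 _] := XY _ Xx0.
rewrite /dH ge_max; apply/andP; split.
- apply: ge_sup; first by exists (inf [set dist R x0 y | y in Y]), x0.
  move=> _ [x Xx <-]; have [y Yy xy] := XY _ Xx.
  apply: le_trans xy; apply: ge_inf; last by exists y.
  by exists 0 => _ [z _ <-]; apply: dist_ge0.
- apply: ge_sup; first by exists (inf [set dist R x y0 | x in X]), y0.
  move=> _ [y Yy <-]; have [x Xx xy] := YX _ Yy.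
  apply: le_trans xy; apply: ge_inf; last by exists x.
  by exists 0 => _ [z _ <-]; apply: dist_ge0.
Qed.

Lemma dH_ge X Y b y : X !=set0 -> Y y ->
  (forall x, X x -> b <= dist R x y) -> b <= dH R X Y.
Proof.
move=> [x0 Xx0] Yy by_; rewrite /dH le_max; apply/orP; right.
apply: (@le_trans _ _ (inf [set dist R x y | x in X])).
  by apply: lb_le_inf; [exists (dist R x0 y), x0 | move=> _ [x Xx <-]; apply: by_].
apply: ub_le_sup; last by exists y.
(* Distances are at most [1], so the supremum over [Y] is a genuine upper bound. *)
exists 1 => _ [z _ <-]; apply: le_trans (dist_le1 x0 z).
by apply: ge_inf; [exists 0 => _ [x _ <-]; apply: dist_ge0 | exists x0].
Qed.

End Distances.

(** * The two estimates for the Hausdorff distance *)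

Section HausdorffBounds.
Variables (A : finType) (S : A -> seq A) (R : realType).
Hypothesis S_gt0 : forall a, (0 < size (S a))%N.

Lemma IHS_orbit (w0 : config A) n m : IHS S R w0 n (shift m (iter n (subst_conf S) w0)).
Proof. by apply: cl_incl; exists m. Qed.

(** A suitable [p] is missing only for the identity on one letter [a]. There [aa] is illegal and
    [(a, a)] carries a loop of [G(S)], so no configuration is a good approximant. *)
Lemma good_approximant_prim (w0 : config A) :
    primitive S -> good_approximant S w0 ->
  exists p, (forall a b : A, b \in iter_subst S p [:: a]) /\
            (forall a, 1 < size (iter_subst S p [:: a]))%N.
Proof.
move=> [p pP] good.
have [p1|/existsNP[a /negP]] := pselect (forall a, (1 < size (iter_subst S p [:: a]))%N).
  by exists p.
rewrite -leqNgt => pa1.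
have Aa b : b = a.
  have := pP a b; have := pP a a; rewrite -/(iter_subst S p _).
  case: (iter_subst S p [:: a]) pa1 => [|c [|]] // _.
  by rewrite !inE => /eqP -> /eqP.
have [Sa|Sa] := ltnP 1 (size (S a)).
  exists 1%N; split=> [b c|b]; rewrite /iter_subst /= /subst_word /= cats0 (Aa b) //.
  by case: (S a) Sa => // d s _; rewrite (Aa c) (Aa d) mem_head.
have SaE : S a = [:: a].
  by have := S_gt0 a; case: (S a) Sa => [|b [|]] // _ _; rewrite (Aa b).
have illegal : ~ legal S [:: a; a].
  move=> [n [b]]; rewrite (Aa b) => /size_infix.
  suff -> : iter n (subst_word S) [:: a] = [:: a] by [].
  by elim: n => // n IHn; rewrite iterS IHn /subst_word /= SaE.
have := good 0 [:: (a, a)]; rewrite (Aa (w0 0)) (Aa (w0 (0 + 1))) /= inE eqxx.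
suff -> : Gedge S (a, a) (a, a) by move=> /(_ isT).
by rewrite /Gedge /= SaE infix_refl andbT andbb; apply/asboolPn.
Qed.

Section Upper.
Variable p : nat.
Hypothesis p_prim : forall a b : A, b \in iter_subst S p [:: a].
Hypothesis p_gt1 : forall a : A, (1 < size (iter_subst S p [:: a]))%N.

Lemma legal_pairs_recurrent : exists q, forall a b, legal S [:: a; b] ->
  forall k c, (q <= k)%N -> infix [:: a; b] (iter_subst S k [:: c]).
Proof.
have q_ex (u : A * A) : exists q, legal S [:: u.1; u.2] ->
    forall k c, (q <= k)%N -> infix [:: u.1; u.2] (iter_subst S k [:: c]).
  have [lu|nlu] := pselect (legal S [:: u.1; u.2]); last by exists 0%N.
  by have [q uq] := legal_recurrent S_gt0 p_prim lu; exists q.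
pose q u := projT1 (cid (q_ex u)); exists (\max_u q u)%N => a b lab k c qk.
apply: (projT2 (cid (q_ex (a, b))) lab); apply: leq_trans qk.
exact: (leq_bigmax (a, b)).
Qed.

Lemma Omega_nonempty (a : A) : Omega S !=set0.
Proof.
have [|z Oz _] := @Omega_extension A S 0 (fun=> a) (legal_extend S_gt0 p_prim p_gt1).
  by rewrite subword1; exists 0%N, a; rewrite infix_refl.
by exists z.
Qed.

(** [N] depends on [S] only: from [#|A|^2] steps on all pairs are legal, and from [q] steps on every
    legal pair occurs in the image of each letter. The other [m] steps make blocks as long as the
    window. *)
Lemma dH_IHS_window : exists N, forall w0, good_approximant S w0 ->
  forall m r, (forall a, (2 * r).+1 <= size (iter_subst S m [:: a]))%N ->
  dH R (IHS S R w0 (m + N)) (Omega S) <= (r.+2%:R)^-1.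
Proof.
have [q qP] := legal_pairs_recurrent; exists (maxn #|{: A * A}| q) => w0 good m r rm.
set N := maxn _ _; set x := iter (m + N) (subst_conf S) w0.
apply: dH_le; first by exists (shift 0 x); apply: IHS_orbit.
- move=> y /(cl_agree r.+1)[_ [s _ <-] /[dup] yx /agree_subword yxE].
  have [|z Oz yz] := @Omega_extension A S r y (legal_extend S_gt0 p_prim p_gt1).
    rewrite yxE subword_shift -/x.
    have [off tl] := iter_subst_conf_tiling (iter N (subst_conf S) w0) m S_gt0.
    rewrite -iterD -/x in tl.
    have [a|k xk] := tiling_window (- r%:Z - s) tl _ rm.
      exact: (size_iter_subst S_gt0 m [:: a]).
    apply: legal_infix xk _; rewrite -iter_subst_cat -[_ ++ _]/([:: _; _]) -subword2.
    apply: legal_iter_subst; apply: good_approximant_legal => //.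
    exact: leq_maxl.
  by exists z => //; apply: dist_le.
- move=> z Oz; set v := subword z (- r%:Z) (2 * r).+1.
  have [|a [b [lab vab]]] := legal_desubst S_gt0 p_prim p_gt1 (v := v) (m := m) _ (Oz _ _).
    by move=> a; rewrite size_subword.
  have [off tl] := iter_subst_conf_tiling w0 (m + N) S_gt0.
  have : infix v (subword x (off 0) (size (iter_subst S (m + N) [:: w0 0]))).
    rewrite (tl 0).2 iter_substD; apply: infix_trans vab _.
    by apply: iter_subst_infix; apply: qP => //; apply: leq_maxr.
  move=> /infix_subword[j]; rewrite size_subword => jE.
  (* This shift moves the occurrence of [v] at [j] to position [-r]. *)
  exists (shift (- r%:Z - j) x); first exact: IHS_orbit.
  apply: dist_le; apply/agree_subword; rewrite subword_shift -/v -jE.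
  by congr subword; lia.
Qed.

Lemma dH_IHS_upper (theta c C : R) : 0 < c -> 0 < C ->
    (forall n a, c * theta ^+ n <= (size (iter_subst S n [:: a]))%:R
                   <= C * theta ^+ n) ->
  exists C1, 0 < C1 /\ forall w0, good_approximant S w0 ->
    forall n, dH R (IHS S R w0 n) (Omega S) <= C1 / theta ^+ n.
Proof.
move=> c0 C0 growth; have [N NP] := dH_IHS_window.
(* A letter is needed to refute [theta^N <= 0], and it becomes available only with [w0]; hence the
   placeholder constant [1]. *)
have [thN|thN] := ltP 0 (theta ^+ N); last first.
  exists 1; split=> // w0 _ n; have /andP[_] := growth N (w0 0).
  have := size_iter_subst S_gt0 N [:: w0 0]; rewrite -(ler_nat R) => s1.
  move=> /(le_trans s1); rewrite leNgt => /negP[].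
  by apply: le_lt_trans ltr01; rewrite pmulr_rle0.
(* The summand [C] serves [n < N], through [c theta^n <= |S^n(a)| <= |S^N(a)| <= C theta^N]; the
   summand [2] serves [n >= N], through [1/(r+2) <= 2/l]. *)
exists ((2 + C) / c * theta ^+ N); split.
  by rewrite mulr_gt0 // divr_gt0 // addr_gt0.
move=> w0 good n.
have th k : 0 < theta ^+ k.
  have /andP[_] := growth k (w0 0); have := size_iter_subst S_gt0 k [:: w0 0].
  rewrite -(ler_nat R) => s1 /(le_trans s1) /(lt_le_trans ltr01).
  by rewrite pmulr_rgt0.
have [nN|Nn] := ltnP n N.
  apply: (@le_trans _ _ 1).
    have [z Oz] := Omega_nonempty (w0 0).
    have xI := @IHS_orbit w0 n 0.
    apply: dH_le; first by exists (shift 0 (iter n (subst_conf S) w0)).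
      by move=> x _; exists z => //; apply: dist_le1.
    by move=> y _; exists (shift 0 (iter n (subst_conf S) w0)) => //; apply: dist_le1.
  rewrite ler_pdivlMr // mul1r mulrAC ler_pdivlMr // mulrC.
  have /andP[+ _] := growth n (w0 0) => /le_trans; apply.
  apply: (@le_trans _ _ (size (iter_subst S N [:: w0 0]))%:R).
    by rewrite ler_nat leq_size_iter_subst // ltnW.
  have /andP[_ /le_trans] := growth N (w0 0); apply.
  by rewrite ler_wpM2r ?ltW // ltrDr.
pose m := (n - N)%N; have nE : n = (m + N)%N by rewrite subnK.
case: (@arg_minnP _ (w0 0) xpredT (fun a => size (iter_subst S m [:: a])) isT) => a _ aP.
set l := size (iter_subst S m [:: a]) in aP.
have l0 : (0 < l)%N := size_iter_subst S_gt0 m [:: a].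
(* The largest [r] with [2r + 1 <= l], where [l] is the shortest length of an [m]-th image. *)
have := NP w0 good m (l.-1)./2; rewrite -nE => /(_ _)/le_trans; apply.
  by move=> b; apply: leq_trans (aP b isT); lia.
have /andP[cl _] := growth m a; rewrite -/l in cl.
apply: (@le_trans _ _ (2 / l%:R)).
  rewrite ler_pdivlMr ?ltr0n // mulrC ler_pdivrMr ?ltr0n // -natrM ler_nat.
  lia.
rewrite ler_pdivrMr ?ltr0n // mulrAC ler_pdivlMr //.
rewrite nE exprD mulrA [leRHS]mulrAC ler_pM2r //.
apply: (@le_trans _ _ ((2 + C) / c * (c * theta ^+ m))); last first.
  by rewrite ler_wpM2l // divr_ge0 ?ltW // addr_gt0.
by rewrite mulrA divfK ?gt_eqF // ler_wpM2r ?ltW // ltrDl.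
Qed.

End Upper.

(** Shift invariance spreads the equality at [0] to all positions, so an element of [Omega] is
    determined by its letters on one period. *)
Lemma periodic_Omega_finite (P : nat) : (0 < P)%N ->
  (forall z, Omega S z -> z 0 = z P%:Z) -> finite_set (Omega S).
Proof.
case: P => // P _ zP.
have per (z : config A) i : Omega S z -> z (i + P.+1%:Z) = z i.
  move=> Oz; have := zP _ (Omega_shift (- i) Oz).
  by rewrite /shift opprK add0r addrC => <-.
have perM (z : config A) (k : int) i : Omega S z -> z (k * P.+1%:Z + i) = z i.
  move=> Oz; elim/int_rect: k => [|k IHk|k IHk]; first by rewrite mul0r add0r.
  - by rewrite -addn1 PoszD mulrDl mul1r addrAC per.
  - by rewrite -[LHS]per // -IHk; congr z; lia.
pose g (f : {ffun 'I_P.+1 -> A}) : config A := fun n => f (inord (absz (n %% P.+1%:Z)%Z)).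
apply: (@sub_finite_set _ _ (g @` setT)); last exact/finite_image/finite_finset.
move=> z Oz; exists [ffun i : 'I_P.+1 => z (Posz i)] => //; apply/funext => n.
rewrite /g ffunE [in RHS](divz_eq n P.+1%:Z) perM //.
have n0 : 0 <= (n %% P.+1%:Z)%Z by rewrite modz_ge0.
have nP : (n %% P.+1%:Z)%Z < P.+1%:Z by rewrite ltz_pmod.
by rewrite inordK ?gez0_abs //; lia.
Qed.

Lemma size_subst_word_le (T : A -> seq A) (B : R) (s : seq A) :
  (forall a, (size (T a))%:R <= B) -> (size (subst_word T s))%:R <= (size s)%:R * B.
Proof.
move=> TB; elim: s => [|a s IHs]; first by rewrite mul0r.
rewrite /subst_word /= size_cat natrD -/(subst_word T s) -natr1 mulrDl mul1r addrC.
exact: lerD.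
Qed.

Lemma dH_IHS_lower (theta C : R) (w0 : config A) : 0 < C ->
    (forall n a, (size (iter_subst S n [:: a]))%:R <= C * theta ^+ n) ->
    infinite_set (Omega S) -> periodic w0 ->
  exists C2, 0 < C2 /\ forall n, C2 / theta ^+ n <= dH R (IHS S R w0 n) (Omega S).
Proof.
move=> C0 growth infO [u [u0 w0u]]; set q := size u in u0 w0u.
have w0q (i : int) : w0 (i + q%:Z) = w0 i.
  by rewrite (w0u (i + _)) (w0u i); congr (nth _ _ (absz _)); apply: modzDr.
have qC : 0 < 2 * q%:R * C by rewrite !mulr_gt0 ?ltr0n.
(* The distance is at least [1/(P+1)], while [P + 1 <= 2P] and [P <= q C theta^n]. *)
exists (2 * q%:R * C)^-1; rewrite invr_gt0; split=> // n.
set x := iter n (subst_conf S) w0.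
have [off tl] := iter_subst_conf_tiling w0 n S_gt0.
have T0 a : (0 < size (iter_subst S n [:: a]))%N := size_iter_subst S_gt0 n [:: a].
have xP := tiling_periodic tl T0 w0q; rewrite -/x in xP.
set T := (fun a => iter_subst S n [:: a]) in tl xP.
set P := size _ in xP.
have P0 : (0 < P)%N.
  have qE : q = (1 + q.-1)%N by rewrite add1n prednK.
  rewrite /P qE subwordD subword1 subst_word_cat size_cat.
  by rewrite /subst_word /= cats0; apply: ltn_addr; apply: T0.
have PC : P%:R <= q%:R * (C * theta ^+ n).
  by have := @size_subst_word_le T _ (subword w0 0 q) (growth n); rewrite size_subword.
have th : 0 < theta ^+ n.
  rewrite -(pmulr_rgt0 _ C0) -(pmulr_rgt0 _ (_ : 0 < q%:R)) ?ltr0n //.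
  by apply: lt_le_trans PC; rewrite ltr0n.
apply: (@le_trans _ _ (P.+1%:R)^-1).
  rewrite -invfM lef_pV2 ?posrE ?mulr_gt0 ?ltr0n //.
  apply: (@le_trans _ _ (2 * P%:R)).
    by rewrite -natrM ler_nat; lia.
  by rewrite -!mulrA ler_pM2l.
have [z Oz zP] : exists2 z, Omega S z &
    forall y, IHS S R w0 n y -> (P.+1%:R)^-1 <= dist R y z.
  apply: contrapT => no; apply: infO; apply: (periodic_Omega_finite P0) => z Oz.
  have [y yI yz] : exists2 y, IHS S R w0 n y & dist R y z < (P.+1%:R)^-1.
    apply: contrapT => noy; apply: no; exists z => // y yI.
    by rewrite leNgt; apply/negP => yz; apply: noy; exists y.
  (* Distance below [1/(P+1)] gives agreement for [|j| <= P], just enough to compare positions [0]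
     and [P]. *)
  have {}yz := dist_lt_agree yz.
  have [_ [s _ <-] ys] := cl_agree P.+1 yI.
  rewrite -!yz ?absz_nat // !ys // /shift -/x.
  by rewrite -[LHS]xP; congr x; lia.
by apply: dH_ge zP => //; exists (shift 0 x); apply: IHS_orbit.
Qed.

End HausdorffBounds.

Theorem theorem2 (A : finType) (R : realType) (S : A -> seq A)
    (HS : forall a : A, (0 < size (S a))%N) (Hprim : primitive S)
    (theta : R) (Htheta : PF_eigenvalue S theta) :
  (exists C1 : R, 0 < C1 /\
     forall w0 : config A, good_approximant S w0 ->
       forall n : nat, dH R (IHS S R w0 n) (Omega S) <= C1 / theta ^+ n)
  /\
  (infinite_set (Omega S) ->
     forall w0 : config A, good_approximant S w0 -> periodic w0 ->
       exists C2 : R, 0 < C2 /\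
         forall n : nat, C2 / theta ^+ n <= dH R (IHS S R w0 n) (Omega S)).
Proof.
have [p0 p0_prim] := Hprim.
have [c [C [c0 [C0 growth]]]] := size_iter_subst_growth Htheta p0_prim.
split; last first.
  move=> infO w0 _; apply: (@dH_IHS_lower _ _ _ HS theta C) => // n a.
  by have /andP[] := growth n a.
have [[p [p_prim p_gt1]]|noprim] := pselect (exists p,
    (forall a b : A, b \in iter_subst S p [:: a]) /\
    (forall a, 1 < size (iter_subst S p [:: a]))%N).
  exact: (dH_IHS_upper HS p_prim p_gt1 c0 C0 growth).
(* Without such a [p] there is no good approximant, and any constant serves. *)
exists 1; split=> // w0 good; case: noprim.
exact: good_approximant_prim good.
Qed.
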